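(* Consider the Best-Fit algorithm in the random-order model restricted to inputs in which every item has size in $(1/3,1]$. Then its asymptotic random-order ratio equals $1$, i.e. $$\limsup_{m\to\infty}\ \sup_{I:\ \mathrm{Opt}(I)=m,\ \text{all sizes in }(1/3,1]}\ \frac{\mathbb E_\sigma[\mathrm{BF}(I_\sigma)]}{\mathrm{Opt}(I)}=1.$$
   Context: Bin packing: items with sizes in $(0,1]$ are to be partitioned into the minimum number $\mathrm{Opt}(I)$ of bins of total size at most $1$. Best-Fit (BF) is the online algorithm that packs each arriving item into the fullest bin (highest total size) in which it fits, opening a new bin if it fits in no open bin; $\mathrm{BF}(L)$ is the number of bins it uses on list $L$. In the random-order model, an adversary fixes the list $I=(x_1,\dots,x_n)$, $\sigma$ is drawn uniformly at random from the permutations of $[n]$, and the items arrive in the order $I_\sigma=(x_{\sigma(1)},\dots,x_{\sigma(n)})$. *)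

(* Defs.v *)
From HB Require Import structures.
From mathcomp Require Import all_boot all_order all_algebra all_fingroup.
From mathcomp Require Import all_classical all_reals all_analysis.
Set Implicit Arguments. Unset Strict Implicit. Unset Printing Implicit Defensive.
Import Order.TTheory GRing.Theory Num.Theory.
Local Open Scope ring_scope.

Section BinPacking.
Variable R : realType.

Definition valid_item (x : R) : bool := (0 < x) && (x <= 1).

Definition packable (I : seq R) (k : nat) : Prop :=
  exists f : 'I_(size I) -> 'I_k,
    forall b : 'I_k, \sum_(i < size I | f i == b) nth 0 I i <= 1.

Definition is_Opt (I : seq R) (m : nat) : Prop :=
  packable I m /\ forall k, packable I k -> (m <= k)%N.

(* One Best-Fit step.  State = list of bin loads (in opening order).
   The item goes into the fullest bin in which it fits (first such in case of
   ties; ties do not affect the number of bins), else a new bin is opened. *)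
Definition bf_step (loads : seq R) (x : R) : seq R :=
  let fits := [seq i <- iota 0 (size loads) | nth 0 loads i + x <= 1] in
  if fits is j0 :: _ then
    let j := foldl (fun b i => if nth 0 loads b < nth 0 loads i then i else b)
                   j0 fits in
    set_nth 0 loads j (nth 0 loads j + x)
  else rcons loads x.

Definition BF (L : seq R) : nat := size (foldl bf_step [::] L).

Definition permute_list (I : seq R) (s : 'S_(size I)) : seq R :=
  [seq nth 0 I (s i) | i <- enum 'I_(size I)].

Definition E_BF (I : seq R) : R :=
  (\sum_(s : 'S_(size I)) (BF (permute_list s))%:R) / ((size I)`!)%:R.

Definition sup_ratio_third (m : nat) : \bar R :=
  ereal_sup [set (E_BF I / m%:R)%:E | I in
    [set I : seq R | all (fun x => (1/3 < x) && (x <= 1)) I /\ is_Opt I m]].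

End BinPacking.

(* Main.v *)
Require Import Defs.
From HB Require Import structures.
From mathcomp Require Import all_boot all_order all_algebra all_fingroup.
From mathcomp Require Import all_classical all_reals all_analysis.
From mathcomp Require Import lra zify ring.
Import Order.TTheory GRing.Theory Num.Theory.
Local Open Scope ring_scope.

Set Implicit Arguments.
Unset Strict Implicit.
Unset Printing Implicit Defensive.

(** In every Best-Fit or optimal packing of items larger than 1/3, a bin holds at
    most two items: big items (at least 2/3) stay alone, and a large item (between
    1/2 and 2/3) can only share its bin with a medium one (at most 1/2).  Hence
    2 BF is, up to 1, the number of items plus the number of bins with a single
    big or large item, and everything reduces to bounding the unmatched large items.

    For a threshold c, call "wasted" the medium items x <= c that are not paired
    with a large item l >= 1 - c.  Over a time interval, Best-Fit does at least as
    well as if, for some c' <= c, all medium items below c' that arrive in it were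
    paired with large items above 1 - c' already present at its start.  Since in
    random order the prefix counts of all thresholds are close to proportional
    (second moments over a grid of times and thresholds), induction over a time
    grid shows that the waste at time t is at most t / n times the slack that
    threshold c has in an optimal packing, up to o(n). *)

(** * Best-Fit on items larger than 1/3: counting bins and following cuts *)

Section BestFitDynamics.
Variable R : realType.
Implicit Types (l p L : seq R) (P Q : pred R) (x y a b : R).

Definition down_closed P := forall x y, x <= y -> P y -> P x.

(* [P] plays the role of a threshold c, strict or not.  A large item [l] of the
   cut fits only with medium items of the cut, as [x <= 1 - l] implies [P x]. *)
Definition med P x := (x <= 1/2) && P x.
Definition lar P x := [&& 1/2 < x, x < 2/3 & P (1 - x)].
Definition big x := 2/3 <= x.

Lemma foldl_argmax (u : nat -> R) (s : seq nat) (j0 : nat) :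
  let j := foldl (fun k i => if u k < u i then i else k) j0 s in
  j \in j0 :: s /\ forall i, i \in j0 :: s -> u i <= u j.
Proof.
elim: s j0 => [|i s IH] j0 /=.
  by split=> [|i]; rewrite mem_seq1 // => /eqP->.
have [jin jmax] := IH (if u j0 < u i then i else j0).
split.
  move: jin; rewrite !inE; case: ifP => _ /orP[->|->]; rewrite ?orbT //.
move=> k; rewrite !inE => /or3P[/eqP->|/eqP->|ks].
- apply: le_trans (jmax _ (mem_head _ _)).
  by case: ltP => // /ltW.
- apply: le_trans (jmax _ (mem_head _ _)).
  by case: ltP.
- by apply: jmax; rewrite inE ks orbT.
Qed.

(** Splitting the loads around [a] removes the index arithmetic, and the maximality of [a] holds
    whichever of several equal loads the tie-breaking picks. *)
Variant bf_step_spec l x : seq R -> Prop :=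
| BFOld l1 a l2 of l = l1 ++ a :: l2 & a + x <= 1
    & {in l, forall b, b + x <= 1 -> b <= a} :
    bf_step_spec l x (l1 ++ (a + x) :: l2)
| BFNew of {in l, forall b, 1 < b + x} : bf_step_spec l x (rcons l x).

Lemma bf_stepP l x : bf_step_spec l x (bf_step l x).
Proof.
rewrite /bf_step.
set fits := [seq i <- iota 0 (size l) | nth 0 l i + x <= 1].
have fitsE i : i \in fits = (i < size l)%N && (nth 0 l i + x <= 1).
  by rewrite mem_filter mem_iota /= add0n andbC.
case Ef: fits => [|j0 s].
  constructor=> b /(nthP 0)[i ilt <-]; rewrite ltNge; apply/negP => le1.
  by have := fitsE i; rewrite Ef ilt le1.
have [] := foldl_argmax (nth 0 l) s j0.
(* The fold in [bf_step] starts at [j0] and visits [j0] again as the head of [fits]; that visit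
   changes nothing because [<] is irreflexive. *)
rewrite -Ef [foldl _ _ fits](_ : _ = foldl
  (fun k i => if nth 0 l k < nth 0 l i then i else k) j0 s); last first.
  by rewrite Ef /= ltxx.
set j := foldl _ _ _ => /=; rewrite fitsE => /andP[jlt jfit] jmax.
rewrite set_nthE jlt; apply: BFOld => //.
  by rewrite -drop_nth // cat_take_drop.
move=> b /(nthP 0)[i ilt <-] ifit; apply: jmax; by rewrite fitsE ilt.
Qed.

(** A second load of at most 1/2 never appears: the item opening it would have fit into the first
    such bin. *)
Definition bf_inv l := all (fun x => 1/3 < x) l && (count (med predT) l <= 1)%N.

Lemma count_catcons (T : Type) (p : pred T) s1 (z : T) s2 :
  count p (s1 ++ z :: s2) = (p z + count p (s1 ++ s2))%N.
Proof. by rewrite !count_cat /= addnCA. Qed.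

Lemma sub_in_count (T : eqType) (p q : pred T) (s : seq T) :
  {in s, subpred p q} -> (count p s <= count q s)%N.
Proof.
move=> pq; rewrite -(@eq_in_count _ (predI p q)); last first.
  by move=> x xs /=; case px: (p x) => //=; rewrite pq.
by apply: sub_count => x /andP[].
Qed.

Lemma count_rcons (T : Type) (p : pred T) s (z : T) :
  count p (rcons s z) = (p z + count p s)%N.
Proof. by rewrite -cats1 count_catcons cats0. Qed.

Lemma bf_step_lb l x : 1/3 < x -> all (fun x => 1/3 < x) l ->
  all (fun x => 1/3 < x) (bf_step l x).
Proof.
move=> x13; case: bf_stepP => [l1 a l2 -> _ _|_].
  by rewrite !all_cat /= => /and3P[-> a13 ->]; rewrite andbT; lra.
by rewrite all_rcons x13.
Qed.

(* The three kinds of bins that can still be told apart by their load alone: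
   a load below 2/3 comes from a single item. *)
Lemma bf_step_size l x : 1/3 < x -> bf_inv l ->
  bf_inv (bf_step l x) /\
  (2 * size (bf_step l x) + count (lar predT) l + count (med predT) l
   = 2 * size l + count (lar predT) (bf_step l x)
     + count (med predT) (bf_step l x) + 1 + big x)%N.
Proof.
move=> x13 /andP[l13 lmed]; rewrite /bf_inv bf_step_lb //=.
have [l1 a l2 lE ax amax|nofit] := bf_stepP l x.
  have a13 : 1/3 < a.
    by move/allP: l13; apply; rewrite lE mem_cat mem_head orbT.
  move: lmed; rewrite lE !count_catcons !size_cat /=.
  (* Both [a] and [x] exceed 1/3 and together are at most 1. So [a + x] exceeds 2/3 and leaves both
     load classes, while [a] is below 2/3 and lay in exactly one of them. *)
  have -> : big x = false by rewrite /big; lra.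
  have -> : med predT (a + x) = false by rewrite /med; lra.
  have -> : lar predT (a + x) = false by rewrite /lar; lra.
  have -> : lar predT a = ~~ med predT a.
    by rewrite /lar /med !andbT -ltNge; case: ltP => //= _; lra.
  by case: (med _ a) => /=; split; lia.
rewrite !count_rcons size_rcons.
have : (med predT x -> count (med predT) l = 0)%N.
  rewrite /med andbT => xmed; apply/eqP; rewrite -leqn0 leqNgt -has_count.
  apply/hasPn => b bl; rewrite /med andbT.
  by have := nofit b bl; lra.
have -> : lar predT x = ~~ med predT x && ~~ big x.
  by rewrite /lar /med /big !andbT -ltNge -ltNge.
case m: (med _ x) => /=.
  have -> : big x = false by move: m; rewrite /med /big; lra.
  by move=> /(_ isT) ->; split; lia.
by case: (big x) => _; split; lia.
Qed.

Lemma bf_run_size l p : all (fun x => 1/3 < x) p -> bf_inv l ->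
  let l' := foldl (@bf_step R) l p in
  bf_inv l' /\
  (2 * size l' + count (lar predT) l + count (med predT) l
   = 2 * size l + count (lar predT) l' + count (med predT) l'
     + size p + count big p)%N.
Proof.
elim: p l => [|x p IH] l /=; first by split=> //; lia.
move=> /andP[x13 p13] li.
have [li' e1] := bf_step_size x13 li.
by have [li'' e2] := IH _ p13 li'; split=> //; lia.
Qed.

(* When a medium item [y] of the cut [P'] does not meet a large item of [P'],
   Best-Fit guarantees that no large item of [P'] in the current loads fits
   with [y], so the cut can be lowered to the items smaller than [y]. *)
Lemma bf_run_cut l p P : all (fun x => 1/3 < x) p ->
  all (fun x => 1/3 < x) l -> down_closed P ->
  exists2 P', down_closed P' & subpred P' P /\
   (count (med P') p + count (lar P) (foldl (@bf_step R) l p)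
    <= count (lar P') l + count (lar P) p)%N.
Proof.
move=> + + dP; elim: p l => [|y p IH] l /=.
  by exists P => //; split=> //; rewrite add0n addn0.
move=> /andP[y13 p13] l13.
have [P' dP' [sP' le]] := IH _ p13 (bf_step_lb y13 l13).
(* The induction hypothesis fixes the cut [P'] for the later arrivals; the first arrival [y] either
   keeps it or lowers it once more. *)
pose ok l1 := exists2 P'', down_closed P'' & subpred P'' P' /\
    (med P'' y + count (lar P') l1 <= count (lar P'') l + lar P y)%N.
suff [P'' dP'' [sP'' le'']] : ok (bf_step l y).
  exists P'' => //; split=> [x /sP''/sP' //|].
  have : (count (med P'') p <= count (med P') p)%N.
    by apply: sub_count => x /andP[xm /sP'' Px]; apply/andP.
  by lia.
have keep l1 : (med P' y + count (lar P') l1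
    <= count (lar P') l + lar P y)%N -> ok l1.
  by move=> le1; exists P' => //; split.
(* The new cut is strict, so [y] itself is not counted. A large load [b] of [P'] with [1 < b + y]
   has [1 - b < y], so it stays in the lowered cut. *)
have lower l1 : P' y -> (count (lar P') l1 <= count (lar P') l)%N ->
    {in l, forall b, lar P' b -> 1 < b + y} -> ok l1.
  move=> Py cnt nofit; exists (fun x => x < y).
    by move=> u v uv vy; exact: le_lt_trans vy.
  split=> [x xy|]; first exact: dP' (ltW xy) Py.
  rewrite {1}/med ltxx andbF add0n; apply: leq_trans (leq_addr _ _).
  apply: leq_trans cnt _.
  apply: sub_in_count => b bl lb; have := nofit b bl lb.
  by move: lb => /and3P[b1 b2 _] by1; rewrite /lar b1 b2 /=; lra.
case: bf_stepP => [l1 a l2 lE ay amax|nofit].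
  have a13 : 1/3 < a.
    by move/allP: l13; apply; rewrite lE mem_cat mem_head orbT.
  have cE : (count (lar P') l = lar P' a + count (lar P') (l1 ++ l2))%N.
    by rewrite lE count_catcons.
  have cE' : count (lar P') (l1 ++ (a + y) :: l2)
      = count (lar P') (l1 ++ l2).
    rewrite count_catcons.
    by have -> : lar P' (a + y) = false by rewrite /lar; lra.
  case: (boolP (med P' y)) => [/andP[ym Py]|/negbTE ny]; last first.
    by apply: keep; rewrite ny cE cE'; lia.
  case: (boolP (lar P' a)) => [aP|/negP naP].
    by apply: keep; rewrite cE cE' aP; case: (med _ _) => /=; lia.
  apply: lower Py _ _; first by rewrite cE cE'; lia.
  (* The best-fit rule enters here: if a large load [b] of [P'] could take [y], the chosen load [a]
     would be at least [b], hence itself a large load of [P']. *)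
  move=> b bl /and3P[b1 b2 Pb]; rewrite ltNge; apply/negP => fit.
  apply: naP; have ba := amax b bl fit; apply/and3P; split; try by lra.
  by apply: dP' Pb; lra.
case: (boolP (med P' y)) => [/andP[ym Py]|/negbTE ny].
  apply: lower Py _ _ => [|b bl _]; last exact: nofit.
  rewrite count_rcons.
  by have -> : lar P' y = false by rewrite /lar; lra.
apply: keep; rewrite count_rcons ny.
have : lar P' y -> lar P y by move=> /and3P[y1 y2 /sP' Py]; apply/and3P.
by case: (lar P' y) => [/(_ isT)->|_] /=; lia.
Qed.

End BestFitDynamics.

(** * Lower bounds on the optimum from weight functions *)

Section OptimumWeight.
Variable R : realType.
Implicit Types (I s L : seq R) (P : pred R) (x : R).

Lemma count_bigE (T : Type) (p : pred T) (s : seq T) :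
  count p s = (\sum_(x <- s) p x)%N.
Proof.
by rewrite -sum1_count big_mkcond; apply: eq_bigr => x _; case: (p x).
Qed.

Lemma size_kinds L :
  (size L = count (@big R) L + count (lar predT) L + count (med predT) L)%N.
Proof.
rewrite -(count_predT L) !count_bigE -!big_split /=; apply: eq_bigr => x _.
rewrite /big /lar /med /=; case: (ltP x (2/3)); case: (ltP (1/2) x) => //= *.
by exfalso; lra.
Qed.

(** A dual solution of the bin packing linear program, scaled by 2. Big items and large items of the
    cut weigh 2, other large items and medium items outside the cut weigh 1, medium items of the cut
    weigh 0. *)
Definition opt_weight P x : nat :=
  (big x + big x + lar predT x + lar P x + med (predC P) x)%N.

(** Three items overflow a bin. In a pair the smaller item is medium, and next to a large item of
    the cut it lies in the cut by downward closure, so it weighs 0. *)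
Lemma opt_weight_bin P s : down_closed P -> all (fun x => 1/3 < x) s ->
  \sum_(x <- s) x <= 1 -> (\sum_(x <- s) opt_weight P x <= 2)%N.
Proof.
move=> dP.
have w1 x : (opt_weight P x <= 2)%N.
  rewrite /opt_weight /big /lar /med /=.
  case: (ltP x (2/3)) => h1; case: (ltP (1/2) x) => h2 /=; try lra.
  - by case: (P _).
  - by case: (P _).
  - by [].
have w2 x y : 1/3 < x -> x <= y -> x + y <= 1 ->
    (opt_weight P x + opt_weight P y <= 2)%N.
  move=> x13 xy xy1.
  have xm : x <= 1/2 by lra.
  have -> : opt_weight P x = ~~ P x :> nat.
    rewrite /opt_weight /big /lar /med xm.
    have -> : (2/3 <= x) = false by lra.
    by have -> : (1/2 < x) = false by lra.
  case: (ltP (1/2) y) => y2; last first.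
    rewrite /opt_weight /big /lar /med y2.
    have -> : (2/3 <= y) = false by lra.
    have -> : (1/2 < y) = false by lra.
    by rewrite /=; case: (P _); case: (P _).
  rewrite /opt_weight /big /lar /med y2.
  have -> : (2/3 <= y) = false by lra.
  have -> : (y <= 1/2) = false by lra.
  have -> : (y < 2/3) by lra.
  rewrite /=; case Py: (P (1 - y)); last by case: (P _).
  by have -> : P x by apply: dP Py; lra.
case: s => [|x [|y [|z s]]].
- by rewrite big_nil.
- by rewrite !big_seq1 => _ _; exact: w1.
- rewrite !big_cons !big_nil !addr0 addn0 /= andbT => /andP[x13 y13] xy.
  case: (leP x y) => [xy'|/ltW yx]; first exact: w2.
  by rewrite addnC; apply: w2 => //; rewrite addrC.
- rewrite !big_cons /= => /and4P[x13 y13 z13 s13] le1; exfalso.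
  have : 0 <= \sum_(j <- s) j.
    rewrite big_seq; apply: sumr_ge0 => j js.
    by have := allP s13 _ js => /=; lra.
  by lra.
Qed.

Lemma packable_opt_weight P I m : down_closed P -> all (fun x => 1/3 < x) I ->
  packable I m ->
  (2 * count (@big R) I + count (lar predT) I + count (lar P) I
   + count (med (predC P)) I <= 2 * m)%N.
Proof.
move=> dP I13 [f fP].
rewrite mul2n -addnn !count_bigE -!big_split /=.
rewrite (big_nth 0) big_mkord (partition_big f predT) //=.
apply: (@leq_trans (\sum_(b < m) 2)); last first.
  by rewrite sum_nat_const card_ord mulnC.
apply: leq_sum => b _.
have /= := @opt_weight_bin P
  (map (fun i : 'I_(size I) => nth 0 I i)
    [seq i <- enum 'I_(size I) | f i == b]) dP.
rewrite !big_map !big_filter !big_enum_cond; apply; last exact: fP.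
by apply/allP => x /mapP[i _ ->]; apply: (allP I13); apply: mem_nth.
Qed.

End OptimumWeight.

(** * Deterministic bound when all prefix counts are nearly proportional *)

Section EpochGrid.
Variable R : realType.
Variables (L : seq R) (m K : nat) (T : nat -> nat) (D d : R).
Let n : R := (size L)%:R.
Let tau k : R := (T k)%:R / n.
Let loads k := foldl (@bf_step R) [::] (take (T k) L).

Hypothesis L13 : all (fun x => 1/3 < x) L.
Hypothesis Lm : forall P : pred R, down_closed P ->
  (2 * count (@big R) L + count (lar predT) L + count (lar P) L
   + count (med (predC P)) L <= 2 * m)%N.
Hypothesis T0 : T 0 = 0%N.
Hypothesis T_mono : forall k, (T k <= T k.+1)%N.
Hypothesis T_step : forall k, tau k.+1 - tau k <= d.
Hypothesis disc : forall (k : nat) (P : pred R), (k <= K)%N -> down_closed P ->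
  `|(count (med P) (take (T k) L))%:R - tau k * (count (med P) L)%:R| <= D /\
  `|(count (lar P) (take (T k) L))%:R - tau k * (count (lar P) L)%:R| <= D.

(** The gap in the weight bound for the cut [P]; it serves as the rate at which waste may accrue. *)
Let slack P : R := (2 * m)%:R - (2 * count (@big R) L)%:R - (count (lar predT) L)%:R
  - (count (lar P) L)%:R - (count (med (predC P)) L)%:R.

Lemma count_medC P s :
  (count (med P) s + count (med (predC P)) s = count (med (@predT R)) s)%N.
Proof.
rewrite !count_bigE -big_split /=; apply: eq_bigr => x _.
by rewrite /med /=; case: (_ <= _); case: (P x).
Qed.

Lemma slack_ge0 P : down_closed P -> 0 <= slack P.
Proof.
move=> dP; rewrite /slack -!addrA -!opprD !addrA -!natrD subr_ge0 ler_nat.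
exact: Lm.
Qed.

(* Up to the error term, the number of medium items of the cut that were not
   combined with a large item of the cut grows at most linearly in time. *)
Lemma grid_waste k P : (k <= K)%N -> down_closed P ->
  (count (med P) (take (T k) L))%:R - (count (lar P) (take (T k) L))%:R
    + (count (lar P) (loads k))%:R
  <= slack P * tau k + 4 * D * k%:R + (count (med P) L)%:R * d.
Proof.
elim: k P => [|k IH] P kK dP.
  have tau0 : tau 0 = 0 by rewrite /tau T0 mul0r.
  rewrite /loads T0 take0 /= tau0 !mulr0 subrr !add0r.
  apply: mulr_ge0 => //; have := T_step 0; rewrite tau0 subr0.
  by apply: le_trans; exact: divr_ge0.
set p := drop (T k) (take (T k.+1) L).
have takeE : take (T k.+1) L = take (T k) L ++ p.
  by rewrite -[LHS](cat_take_drop (T k)) take_takel.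
have loadsE : loads k.+1 = foldl (@bf_step R) (loads k) p.
  by rewrite /loads takeE foldl_cat.
have p13 : all (fun x => 1/3 < x) p.
  apply/allP => x xp; apply: (allP L13).
  by apply: (@mem_take (T k.+1)); rewrite takeE mem_cat xp orbT.
have l13 : all (fun x => 1/3 < x) (loads k).
  have : all (fun x => 1/3 < x) (take (T k) L).
    by apply/allP => x /mem_take; apply: (allP L13).
  rewrite /loads; elim/last_ind: (take _ _) => //= s x IHs.
  rewrite all_rcons foldl_rcons => /andP[x13 s13].
  by apply: bf_step_lb => //; exact: IHs.
have [P' dP' [sP']] := bf_run_cut p13 l13 dP.
rewrite -loadsE -(ler_nat R) !natrD => le_epoch.
have := IH P' (ltnW kK) dP'.
(* For both cuts, medium counts are compared at the end of the epoch and large counts at its start: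
   four replacements, hence [4 * D] per epoch. *)
have [+ _] := disc kK dP; have [+ _] := disc kK dP'.
have [_ +] := disc (ltnW kK) dP; have [_ +] := disc (ltnW kK) dP'.
have le_med : ((count (med P') L)%:R : R) <= (count (med P) L)%:R.
  by rewrite ler_nat; apply: sub_count => x /andP[xm /sP' Px]; apply/andP.
have slackE : slack P = slack P' + (count (med P) L)%:R - (count (med P') L)%:R
    - (count (lar P) L)%:R + (count (lar P') L)%:R.
  rewrite /slack; have := count_medC P L; have := count_medC P' L.
  move=> /(congr1 (fun z => z%:R : R)) + /(congr1 (fun z => z%:R : R)).
  by rewrite !natrD; lra.
have s0 := slack_ge0 dP.
have tauS : tau k <= tau k.+1.
  by rewrite /tau ler_wpM2r ?invr_ge0 // ler_nat.
(* Comparing medium and large items at the two ends of the epoch costs [d] per medium item between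
   the cuts. Added to the [d] per medium item of [P'] in the induction hypothesis, this is [d] per
   medium item of [P], so this error does not grow with [k]. *)
have f1 : 0 <= ((count (med P) L)%:R - (count (med P') L)%:R)
    * (tau k + d - tau k.+1).
  by apply: mulr_ge0; [rewrite subr_ge0 | have := T_step k; lra].
have f2 : 0 <= slack P * (tau k.+1 - tau k).
  by apply: mulr_ge0; [exact: s0 | rewrite subr_ge0].
rewrite takeE !count_cat !natrD -natr1 !ler_norml.
move: le_epoch f1 f2; rewrite slackE.
generalize (slack P') (tau k.+1) (tau k) => s t' t.
move=> le_epoch f1 f2 /andP[g1 g1'] /andP[g2 g2'] /andP[g3 g3'] /andP[g4 g4'].
lra.
Qed.

(** With the full cut [predT] at the final time, the waste bound limits the bins holding a lone
    large item; the counts of item kinds then cancel against the slack. The final 1 pays for the at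
    most one bin of load at most 1/2. *)
Lemma grid_BF : (0 < size L)%N -> T K = size L ->
  2 * (BF L)%:R <= (2 * m)%:R + 4 * D * K%:R + n * d + 1.
Proof.
move=> n0 TK; have dT : down_closed (@predT R) by [].
have := grid_waste (leqnn K) dT.
have -> : tau K = 1 by rewrite /tau TK divff // pnatr_eq0 -lt0n.
rewrite /loads TK take_size mulr1 /slack.
have -> : count (med (predC predT)) L = 0%N.
  by rewrite (@eq_count _ _ pred0) ?count_pred0 // => x; rewrite /med andbF.
have inv0 : bf_inv ([::] : seq R) by [].
have [/andP[_ W] /= E] := bf_run_size L13 inv0.
have nE := size_kinds L.
have d0 : 0 <= d.
  have := T_step 0; apply: le_trans; rewrite subr_ge0.
  by rewrite /tau ler_wpM2r ?invr_ge0 // ler_nat.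
have Md : (count (med predT) L)%:R * d <= n * d.
  by apply: ler_wpM2r => //; rewrite ler_nat count_size.
have W' : (count (med predT) (foldl (@bf_step R) [::] L))%:R <= 1 :> R.
  by rewrite -[leRHS]/(1%:R) ler_nat.
have E' : 2 * (BF L)%:R = (count (lar predT) (foldl (@bf_step R) [::] L))%:R +
   (count (med predT) (foldl (@bf_step R) [::] L))%:R
   + (size L)%:R + (count (@big R) L)%:R :> R.
  by rewrite -!natrD -natrM; congr (_%:R); move: E; rewrite /BF; lia.
rewrite E'; move: Md; rewrite /n nE !natrD; lra.
Qed.

End EpochGrid.

(** * Concentration of prefix counts under a uniform permutation *)

Section RandomPermutation.
Variables (R : realFieldType) (n : nat).
Implicit Types (r : 'I_n -> R) (S : pred 'I_n) (t : nat) (s : 'S_n).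

(** Transpositions make the correlation with position [i] the same for all other positions. Summed
    over all positions it vanishes since [r] is centered, and the diagonal term is nonnegative. *)
Lemma sum_perm_corr_le0 r (i j : 'I_n) : \sum_a r a = 0 -> i != j ->
  \sum_(s : 'S_n) r (s i) * r (s j) <= 0.
Proof.
move=> r0 ij; rewrite leNgt; apply/negP => pos.
have same k : i != k ->
    \sum_(s : 'S_n) r (s i) * r (s k) = \sum_(s : 'S_n) r (s i) * r (s j).
  move=> ik; rewrite (reindex_inj (mulgI (tperm j k))) /=.
  apply: eq_bigr => s _; rewrite !permM tpermR tpermD 1?eq_sym //.
have : \sum_k \sum_(s : 'S_n) r (s i) * r (s k) = 0.
  rewrite exchange_big big1 // => s _.
  have rs0 : \sum_k r (s k) = 0.
    by rewrite -[RHS]r0 [RHS](reindex_inj (@perm_inj _ s)).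
  by rewrite -mulr_sumr rs0 mulr0.
rewrite (bigD1 j) //= => e0.
suff : 0 <= \sum_(k | k != j) \sum_(s : 'S_n) r (s i) * r (s k).
  by move=> ge0; have := ltr_wpDr ge0 pos; rewrite e0 ltxx.
apply: sumr_ge0 => k _; have [->|ki] := eqVneq k i.
  by apply: sumr_ge0 => s _; rewrite -expr2 sqr_ge0.
by rewrite same 1?eq_sym // ltW.
Qed.

(* Distinct positions of a random permutation are negatively correlated. *)
Lemma sum_perm_sqr_le r (A : pred 'I_n) : \sum_a r a = 0 ->
  (forall a, `|r a| <= 1) ->
  \sum_(s : 'S_n) (\sum_(i | A i) r (s i)) ^+ 2 <= (n * n`!)%:R.
Proof.
move=> r0 r1.
have -> : \sum_(s : 'S_n) (\sum_(i | A i) r (s i)) ^+ 2 =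
    \sum_(i | A i) \sum_(j | A j) \sum_(s : 'S_n) r (s i) * r (s j).
  under eq_bigr => s _ do rewrite expr2 mulr_suml.
  rewrite exchange_big; apply: eq_bigr => i _.
  under eq_bigr => s _ do rewrite mulr_sumr.
  by rewrite exchange_big.
have -> : (n * n`!)%:R = \sum_(i < n) (n`!)%:R :> R.
  by rewrite natrM mulr_natl sumr_const card_ord.
rewrite big_mkcond; apply: ler_sum => i _; case: ifP => // Ai.
rewrite (bigD1 i) //= -[leRHS]addr0; apply: lerD; last first.
  apply: sumr_le0 => j /andP[_ ji]; apply: sum_perm_corr_le0 => //.
  by rewrite eq_sym.
have -> : (n`!)%:R = \sum_(s : 'S_n) 1 :> R by rewrite sumr_const card_Sn.
apply: ler_sum => s _; rewrite -expr2 -real_normK ?num_real //.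
by rewrite expr_le1.
Qed.

Definition deviation S t s : R :=
  \sum_(i < n | (i < t)%N) ((S (s i))%:R - #|S|%:R / n%:R).

(** Pointwise [|x| <= x ^+ 2 / u + u], so the second moment bounds the first without square roots;
    the cutoff [u] is chosen later. *)
Lemma sum_deviation_le S t (u : R) : 0 < u ->
  \sum_(s : 'S_n) `|deviation S t s| <= (n%:R / u + u) * (n`!)%:R.
Proof.
move=> u0; pose r a : R := (S a)%:R - #|S|%:R / n%:R.
have r0 : \sum_a r a = 0.
  have [n0|n_gt0] := posnP n.
    apply: big1 => i _.
    by move: (leq_ltn_trans (leq0n i) (ltn_ord i)); rewrite lt0n => /eqP/(_ n0).
  rewrite sumrB -natr_sum sumr_const card_ord -[X in _ - X]mulr_natl.
  rewrite mulrCA divff ?mulr1 ?pnatr_eq0 -?lt0n //; apply/eqP.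
  rewrite subr_eq0 eqr_nat -sum1_card [eqbRHS]big_mkcond; apply/eqP.
  by apply: eq_bigr => i _; rewrite -[i \in S]/(S i); case: (S i).
have r1 a : `|r a| <= 1.
  have n_gt0 : 0 < n%:R :> R by rewrite ltr0n; apply: leq_ltn_trans (ltn_ord a).
  have : #|S|%:R / n%:R <= 1 :> R.
    by rewrite ler_pdivrMr // mul1r ler_nat -[leqRHS](card_ord n) max_card.
  have : 0 <= #|S|%:R / n%:R :> R by apply: divr_ge0 => //; exact: ltW.
  by rewrite /r ler_norml; case: (S a) => /= h1 h2; apply/andP; split; lra.
have := @sum_perm_sqr_le r (fun i => (i < t)%N) r0 r1.
rewrite -(ler_pM2r (_ : 0 < u^-1)) ?invr_gt0 // natrM => sq.
apply: (@le_trans _ _ (\sum_(s : 'S_n) (deviation S t s ^+ 2 / u + u))).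
  apply: ler_sum => s _; set x := deviation _ _ _.
  case: (leP `|x| u) => [xu|ux].
    by apply: (le_trans xu); rewrite lerDr divr_ge0 ?sqr_ge0 // ltW.
  apply: ler_wpDr; first exact: ltW.
  rewrite ler_pdivlMr // -real_normK ?num_real // expr2.
  by apply: ler_wpM2l => //; exact: ltW.
rewrite big_split /= -mulr_suml sumr_const card_Sn -[u *+ _]mulr_natl.
by apply: le_trans (lerD sq (lexx _)) _; rewrite le_eqVlt; apply/orP; left;
  apply/eqP; ring.
Qed.

Lemma card_lt_ord t : (t <= n)%N -> #|[pred i : 'I_n | (i < t)%N]| = t.
Proof.
move=> tn; rewrite -sum1_card -(big_ord_widen _ (fun=> 1%N)) //.
by rewrite sum_nat_const card_ord muln1.
Qed.

Definition hits S t s : nat := \sum_(i < n | (i < t)%N) S (s i).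

Lemma deviationE S t s : (t <= n)%N ->
  deviation S t s = (hits S t s)%:R - t%:R / n%:R * #|S|%:R.
Proof.
move=> tn; rewrite /deviation /hits sumrB natr_sum sumr_const; congr (_ - _).
by rewrite (card_lt_ord tn) -mulr_natl; ring.
Qed.

(* [C j] consists of the first [j * q] indices in the order of [v]; chains of
   level sets of [v] would jump by more than [q] in case of ties. *)
Lemma rank_chain (v : 'I_n -> R) (q : nat) : (0 < q)%N ->
  exists C : nat -> pred 'I_n, forall A : pred 'I_n,
    (forall i j, A i -> ~~ A j -> v i < v j) ->
    exists j, [/\ (j <= n %/ q)%N, subpred (C j) A, subpred A (C j.+1),
      (#|C j.+1| <= #|A| + q)%N & (#|A| <= #|C j| + q)%N].
Proof.
move=> q0; pose le_v i j := v i <= v j.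
pose o := sort le_v (enum 'I_n).
have o_mem i : i \in o by rewrite mem_sort mem_enum.
have o_uniq : uniq o by rewrite sort_uniq enum_uniq.
have o_size : size o = n by rewrite size_sort size_enum_ord.
have o_sorted : sorted le_v o by apply: sort_sorted => i j; exact: le_total.
pose rk i := index i o.
have rk_lt i : (rk i < n)%N by rewrite -o_size index_mem.
have rk_inj : injective rk.
  by move=> i j e; rewrite -(nth_index i (o_mem i)) -/(rk i) e nth_index.
have card_rk k : (k <= n)%N -> #|[pred i | (rk i < k)%N]| = k.
  move=> kn; rewrite -[RHS](card_lt_ord kn).
  pose g i := Ordinal (rk_lt i).
  have g_inj : injective g by move=> i j [] /rk_inj.
  by rewrite -!sum1_card [RHS](reindex_inj g_inj).
have card_rk_le k : (#|[pred i | (rk i < k)%N]| <= k)%N.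
  have [kn|/ltnW nk] := leqP k n; first by rewrite card_rk.
  by apply: leq_trans (max_card _) _; rewrite card_ord.
have rk_homo i j : (rk i <= rk j)%N -> v i <= v j.
  move=> ij; rewrite -(nth_index i (o_mem i)) -(nth_index i (o_mem j)).
  have tr : transitive le_v by move=> y x z; exact: le_trans.
  have rf : reflexive le_v by move=> x; exact: lexx.
  by apply: (sorted_leq_nth tr rf i o_sorted) ij; rewrite inE o_size rk_lt.
exists (fun j => [pred i | (rk i < j * q)%N]) => A Av.
(* A set lying strictly below its complement splits no tie, so it is a full initial segment of ranks
   however the sort orders equal values. *)
have A_rk i : A i = (rk i < #|A|)%N.
  apply/idP/idP => [Ai|].
    have : (#|[pred k | (rk k < (rk i).+1)%N]| <= #|A|)%N.
      apply: subset_leq_card; apply/fintype.subsetP => k; rewrite !inE ltnS => ki.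
      apply/negPn/negP => /(Av _ _ Ai); rewrite ltNge.
      by rewrite rk_homo.
    by rewrite card_rk // rk_lt.
  apply: contraLR => nAi; rewrite -leqNgt.
  have : (#|A| <= #|[pred k | (rk k < rk i)%N]|)%N.
    apply: subset_leq_card; apply/fintype.subsetP => k kA; rewrite inE.
    rewrite ltnNge; apply/negP => /rk_homo.
    by rewrite leNgt Av.
  by rewrite card_rk // ltnW // rk_lt.
have An : (#|A| <= n)%N by rewrite -[leqRHS]card_ord max_card.
have q1 := leq_divM #|A| q; have q2 := ltn_ceil #|A| q0.
exists (#|A| %/ q)%N; split.
- exact: leq_div2r.
- by move=> i /= ri; rewrite A_rk; exact: leq_trans ri q1.
- by move=> i; rewrite A_rk /= => ri; exact: ltn_trans ri q2.
- by apply: leq_trans (card_rk_le _) _; rewrite mulSn addnC leq_add2r.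
- rewrite card_rk ?(leq_trans q1) //.
  by move: q2; rewrite mulSn addnC => /ltnW.
Qed.

Lemma hits_mono (A B : pred 'I_n) t s : subpred A B ->
  (hits A t s <= hits B t s)%N.
Proof.
move=> AB; apply: leq_sum => i _.
by case a: (A (s i)) => //; rewrite AB.
Qed.

(** [A] is squeezed between consecutive chain members whose cardinals differ from its own by at most
    [q]. The bound no longer mentions [A], so it controls all cuts simultaneously. *)
Lemma chain_deviation (v : 'I_n -> R) (q : nat) : (0 < q)%N ->
  exists C : nat -> pred 'I_n, forall A : pred 'I_n,
    (forall i j, A i -> ~~ A j -> v i < v j) ->
    forall t s, (t <= n)%N ->
    `|(hits A t s)%:R - t%:R / n%:R * #|A|%:R| <=
      q%:R + \sum_(j < (n %/ q).+2) `|deviation (C j) t s|.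
Proof.
move=> q0; have [C CP] := rank_chain v q0.
exists C => A /CP[j [jn CA AC c1 c2]] t s tn.
have dev k : (k <= (n %/ q).+1)%N ->
    `|(hits (C k) t s)%:R - t%:R / n%:R * #|C k|%:R| <=
    \sum_(j < (n %/ q).+2) `|deviation (C j) t s|.
  move=> kn; rewrite -deviationE //.
  rewrite (bigD1 (Ordinal (kn : (k < (n %/ q).+2)%N))) //= lerDl.
  by apply: sumr_ge0.
have := dev _ (leqW jn); have := dev j.+1 jn; move: (\sum_(_ < _) _) => D.
have := hits_mono t s CA; have := hits_mono t s AC.
rewrite -!(ler_nat R) => h1 h2.
have t0 : 0 <= t%:R / n%:R :> R by apply: divr_ge0.
have t1 : t%:R / n%:R <= 1 :> R.
  have [n0|n_gt0] := posnP n; first by rewrite n0 invr0 mulr0.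
  by rewrite ler_pdivrMr ?ltr0n // mul1r ler_nat.
have tq : t%:R / n%:R * q%:R <= q%:R :> R by apply: ler_piMl.
move: c1 c2; rewrite -!(ler_nat R) !natrD.
move=> /(ler_wpM2l t0) + /(ler_wpM2l t0); rewrite !mulrDr => c1 c2.
rewrite !ler_norml => /andP[d1 d2] /andP[d3 d4]; apply/andP; split; lra.
Qed.

End RandomPermutation.

(** * Averaging the deterministic bound over arrival orders *)

Section ExpectedBestFit.
Variable R : realType.
Implicit Types (I : seq R) (P p : pred R).

Lemma take_enum_ord n t : (t <= n)%N ->
  take t (enum 'I_n) = [seq i : 'I_n <- enum 'I_n | (i < t)%N].
Proof.
move=> tn; apply: (inj_map val_inj).
rewrite map_take val_enum_ord take_iota (minn_idPl tn).
rewrite -(@filter_map _ _ val (fun i => (i < t)%N)) val_enum_ord.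
by rewrite -(filter_iota_ltn 0 tn).
Qed.

Lemma count_take_permute I (s : 'S_(size I)) p t : (t <= size I)%N ->
  count p (take t (permute_list s)) = hits (fun i => p (nth 0 I i)) t s.
Proof.
move=> tn; rewrite /permute_list -map_take take_enum_ord // count_bigE.
by rewrite big_map big_filter big_enum_cond.
Qed.

Lemma size_permute_list I (s : 'S_(size I)) : size (permute_list s) = size I.
Proof. by rewrite size_map size_enum_ord. Qed.

Lemma card_nth_pred I p :
  #|(fun i : 'I_(size I) => p (nth 0 I i))| = count p I.
Proof.
rewrite -sum1_card big_mkcond count_bigE (big_nth 0) big_mkord.
by apply: eq_bigr => i _; rewrite unfold_in; case: (p _).
Qed.

Lemma count_permute_list I (s : 'S_(size I)) p :
  count p (permute_list s) = count p I.
Proof.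
rewrite -[permute_list s]take_size size_permute_list count_take_permute //.
rewrite count_bigE (big_nth 0) big_mkord (reindex_inj (@perm_inj _ s)) /=.
by apply: eq_bigl => i; rewrite ltn_ord.
Qed.

(** The chains are chosen before the permutation, so the bound is a fixed finite sum of deviations
    that can be averaged term by term. *)
Lemma BF_permute_le I m K b q : (0 < size I)%N -> (0 < q)%N ->
    (size I <= K * b)%N -> all (fun x => 1/3 < x) I -> packable I m ->
  exists C C' : nat -> pred 'I_(size I), forall s : 'S_(size I),
    2 * (BF (permute_list s))%:R <= (2 * m)%:R + 4 * (q%:R +
      \sum_(k < K.+1) \sum_(j < (size I %/ q).+2)
        (`|deviation R (C j) (minn (k * b) (size I)) s|
         + `|deviation R (C' j) (minn (k * b) (size I)) s|)) * K%:R
      + b%:R + 1.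
Proof.
move=> n0 q0 nKb I13 Im; set n := size I.
(* One chain orders medium items by size, the other large items by [1 - x]. The value 2 ranks all
   remaining items last, so the items selected by a cut form an initial segment. *)
have [C CP] := @chain_deviation R n
  (fun i => if nth 0 I i <= 1/2 then nth 0 I i else 2) q q0.
have [C' CP'] := @chain_deviation R n
  (fun i => if 1/2 < nth 0 I i < 2/3 then 1 - nth 0 I i else 2) q q0.
exists C, C' => s; pose T k := minn (k * b) n.
set D := q%:R + _.
have Dk k : (k <= K)%N ->
   q%:R + \sum_(j < (n %/ q).+2) `|deviation R (C j) (T k) s| <= D /\
   q%:R + \sum_(j < (n %/ q).+2) `|deviation R (C' j) (T k) s| <= D.
  move=> kK; rewrite /D (bigD1 (Ordinal (kK : (k < K.+1)%N))) //=.
  rewrite -/n -/(T k) !lerD2l big_split /=.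
  have : 0 <= \sum_(j < (n %/ q).+2) `|deviation R (C j) (T k) s|.
    exact: sumr_ge0.
  have : 0 <= \sum_(j < (n %/ q).+2) `|deviation R (C' j) (T k) s|.
    exact: sumr_ge0.
  set rest := \sum_(i < K.+1 | _) _.
  have : 0 <= rest.
    by apply: sumr_ge0 => i _; apply: sumr_ge0 => j _; apply: addr_ge0.
  by move=> h1 h2 h3; split; lra.
have Tn k : (T k <= n)%N := geq_minr _ _.
have nR : 0 < n%:R :> R by rewrite ltr0n.
have sz := size_permute_list s.
have -> : b%:R = (size (permute_list s))%:R * (b%:R / n%:R) :> R.
  by rewrite sz mulrCA divff ?mulr1 // gt_eqF.
apply: (@grid_BF R (permute_list s) m K T D (b%:R / n%:R)).
- by apply/allP => x /mapP[i _ ->]; apply: (allP I13); apply: mem_nth.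
- move=> P dP; rewrite !count_permute_list.
  exact: packable_opt_weight.
- by rewrite /T mul0n min0n.
- move=> k; rewrite /T leq_min geq_minr (leq_trans (geq_minl _ _)) //.
  by rewrite leq_mul2r leqnSn orbT.
- move=> k; rewrite sz -mulrBl ler_pM2r ?invr_gt0 // lerBlDr -natrD ler_nat.
  by rewrite /T mulSn; lia.
- move=> k P kK dP; have [D1 D2] := Dk k kK.
  rewrite !count_take_permute // !count_permute_list sz -!card_nth_pred; split.
  + apply: le_trans D1; apply: CP => // i j /andP[im iP]; rewrite im /med.
    case: ifP => [jm|_ _]; last by lra.
    move=> /= njP; rewrite ltNge; apply/negP => ji.
    by move: njP; rewrite (dP _ _ ji iP).
  + apply: le_trans D2; apply: CP' => // i j /and3P[i1 i2 iP].
    rewrite i1 i2 /lar /=.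
    case: ifP => [/andP[j1 j2]|_ _]; last by lra.
    rewrite j1 j2 /= => njP; rewrite ltNge; apply/negP => ji.
    by move: njP; rewrite (dP _ _ ji iP).
- by rewrite sz.
- by rewrite sz /T; apply/minn_idPr.
Qed.

Lemma E_BF_le I m K b q (u : R) : (0 < size I)%N -> (0 < q)%N -> 0 < u ->
    (size I <= K * b)%N -> all (fun x => 1/3 < x) I -> packable I m ->
  2 * E_BF I <= (2 * m)%:R + 4 * (q%:R +
    (K.+1 * (size I %/ q).+2)%:R * 2 * ((size I)%:R / u + u)) * K%:R
      + b%:R + 1.
Proof.
move=> n0 q0 u0 nKb I13 Im.
have [C [C' CP]] := BF_permute_le n0 q0 nKb I13 Im.
set n := size I; set V := n%:R / u + u.
have f0 : 0 < (n`!)%:R :> R by rewrite ltr0n fact_gt0.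
rewrite /E_BF -/n mulrA ler_pdivrMr // mulr_sumr.
apply: le_trans (ler_sum _ (fun s _ => CP s)) _.
have cst (c : R) : \sum_(s : 'S_n) c = c * (n`!)%:R.
  by rewrite sumr_const card_Sn mulr_natr.
pose S (s : 'S_n) := \sum_(k < K.+1) \sum_(j < (n %/ q).+2)
     (`|deviation R (C j) (minn (k * b) n) s|
         + `|deviation R (C' j) (minn (k * b) n) s|).
have dev : \sum_s S s <=
   (K.+1 * (n %/ q).+2)%:R * 2 * V * (n`!)%:R.
  rewrite /S exchange_big natrM.
  have -> : K.+1%:R * (n %/ q).+2%:R * 2 * V * (n`!)%:R =
     \sum_(k < K.+1) \sum_(j < (n %/ q).+2) (V * (n`!)%:R + V * (n`!)%:R) :> R.
    by rewrite !sumr_const !card_ord -mulr_natl -[X in _ * X]mulr_natl; ring.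
  apply: ler_sum => k _; rewrite exchange_big.
  apply: ler_sum => j _; rewrite big_split.
  by apply: lerD; exact: sum_deviation_le.
have -> : \sum_s ((2 * m)%:R + 4 * (q%:R + S s) * K%:R + b%:R + 1) =
    ((2 * m)%:R + 4 * q%:R * K%:R + b%:R + 1) * (n`!)%:R
    + 4 * K%:R * \sum_s S s.
  rewrite mulr_sumr -cst -big_split; apply: eq_bigr => s _ /=; ring.
have K4 : 0 <= 4 * K%:R :> R by apply: mulr_ge0.
have := ler_wpM2l K4 dev; move: (\sum_s S s) => Z h.
apply: le_trans (lerD (lexx _) h) _.
by rewrite le_eqVlt; apply/orP; left; apply/eqP; ring.
Qed.

(** Under the empty cut every item weighs at least 1. This converts errors in the number of items
    into errors in [m]. *)
Lemma packable_size I m : all (fun x => 1/3 < x) I -> packable I m ->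
  (size I <= 2 * m)%N.
Proof.
move=> I13 Im; have d0 : down_closed (@pred0 R) by [].
rewrite size_kinds; have := packable_opt_weight d0 I13 Im.
have -> : count (med (predC pred0)) I = count (med predT) I by exact: eq_count.
by lia.
Qed.

(* Taking N epochs, N^2 thresholds and cutoff u = N^5 makes every error term
   that depends on m of order m / N. *)
Lemma E_BF_asymptotic I m N : (0 < N)%N -> (0 < size I)%N ->
    all (fun x => 1/3 < x) I -> packable I m ->
  E_BF I <= m%:R * (1 + 53 / N%:R) + (1 + 2 * N%:R + 24 * N%:R ^+ 9).
Proof.
move=> N0 n0 I13 Im; have n2m := packable_size I13 Im.
set n := size I in n0 n2m *.
(* Rounding up keeps [q] positive and lets [N] epochs of length [b] cover the list. *)
pose b := (n %/ N).+1; pose q := (n %/ N ^ 2).+1.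
have N2 : (0 < N ^ 2)%N by rewrite expn_gt0 N0.
have nNb : (n <= N * b)%N by rewrite mulnC ltnW // ltn_ceil.
have nq : (n %/ q <= N ^ 2)%N.
  rewrite -ltnS ltn_divLR // mulSn; apply: ltn_addl.
  by rewrite mulnC ltn_ceil.
have NR : 0 < N%:R :> R by rewrite ltr0n.
have u0 : 0 < N%:R ^+ 5 :> R by rewrite exprn_gt0.
have /= := E_BF_le n0 (isT : (0 < q)%N) u0 nNb I13 Im.
rewrite -/n.
set x : R := N%:R in NR u0 *.
have x1 : 1 <= x by rewrite /x ler1n.
have x0 : x != 0 by rewrite gt_eqF.
have bR : b%:R <= 2 * m%:R / x + 1.
  rewrite /b -natr1 lerD2r ler_pdivlMr // -!natrM ler_nat.
  exact: leq_trans (leq_divM _ _) n2m.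
have qR : q%:R * x <= 2 * m%:R / x + x.
  have : q%:R <= 2 * m%:R / x ^+ 2 + 1.
    rewrite /q -natr1 lerD2r ler_pdivlMr ?exprn_gt0 // -natrX -!natrM ler_nat.
    exact: leq_trans (leq_divM _ _) n2m.
  move=> /(ler_wpM2r (ltW NR)) h; apply: le_trans h _.
  by rewrite le_eqVlt; apply/orP; left; apply/eqP; field.
have kR : (N.+1 * (n %/ q).+2)%:R * (n%:R / x ^+ 5 + x ^+ 5) * x
    <= 12 * m%:R / x + 6 * x ^+ 9.
  have -> : 12 * m%:R / x + 6 * x ^+ 9 =
      6 * x ^+ 3 * (2 * m%:R / x ^+ 5 + x ^+ 5) * x by field.
  apply: ler_wpM2r (ltW NR) _ _ _; apply: ler_pM => //.
  - by apply: addr_ge0; [apply: divr_ge0 => // |]; exact: ltW.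
  - have -> : 6 * x ^+ 3 = (6 * N ^ 3)%:R by rewrite natrM natrX.
    rewrite ler_nat; apply: (@leq_trans ((2 * N) * (3 * N ^ 2))).
      by apply: leq_mul; lia.
    by rewrite mulnACA expnS.
  - rewrite lerD2r; apply: ler_wpM2r; first by rewrite invr_ge0 ltW.
    by rewrite -natrM ler_nat.
(* The coefficient of [m / N] in the bound on twice the expectation is 4 * 2 + 8 * 12 + 2 = 106,
   from [qR], [kR] and [bR]; halving gives 53. *)
move: kR qR bR; rewrite natrM.
have -> : m%:R * (1 + 53 / x) = m%:R + 53 * (m%:R / x) by field.
rewrite -!(mulrA _ m%:R x^-1).
lra.
Qed.

End ExpectedBestFit.

(** * Lower bound: lists of unit items have ratio exactly 1 *)

Section UnitItems.
Variable R : realType.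

Lemma nth_ones m (i : 'I_(size (nseq m (1 : R)))) : nth 0 (nseq m (1 : R)) i = 1.
Proof.
by have := mem_nth 0 (ltn_ord i); rewrite mem_nseq => /andP[_ /eqP].
Qed.

Lemma is_Opt_ones m : is_Opt (nseq m (1 : R)) m.
Proof.
split=> [|k [f fP]].
  exists (cast_ord (size_nseq m 1)) => b.
  rewrite (bigD1 (cast_ord (esym (size_nseq m 1)) b)) /= ?cast_ordKV //.
  rewrite big1 => [|i /andP[/eqP <- /negP]]; last by rewrite cast_ordK.
  by rewrite addr0 nth_nseq; case: ifP.
have : \sum_(i < size (nseq m (1 : R))) nth 0 (nseq m (1 : R)) i
    <= \sum_(b < k) 1.
  by rewrite (partition_big f predT) //; apply: ler_sum => b _; exact: fP.
rewrite (eq_bigr (fun=> 1)) => [|i _]; last first.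
  exact: nth_ones.
by rewrite !sumr_const !card_ord size_nseq ler_nat.
Qed.

Lemma permute_ones m (s : 'S_(size (nseq m (1 : R)))) :
  permute_list s = nseq m 1.
Proof.
apply: (@eq_from_nth _ 0); rewrite size_permute_list // => i im.
rewrite (nth_map (Ordinal im)) ?size_enum_ord // nth_ones.
exact/esym/(nth_ones (Ordinal im)).
Qed.

Lemma BF_ones m : BF (nseq m (1 : R)) = m.
Proof.
rewrite /BF; suff -> : foldl (@bf_step R) [::] (nseq m 1) = nseq m 1.
  by rewrite size_nseq.
elim: m => // m IH.
have -> : nseq m.+1 (1 : R) = rcons (nseq m 1) 1 by rewrite -cats1 -addn1 nseqD.
rewrite foldl_rcons IH.
case: bf_stepP => [l1 a l2 lE a1 _|//].
have : a \in nseq m (1 : R) by rewrite lE mem_cat mem_head orbT.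
by rewrite mem_nseq => /andP[_ /eqP aE]; move: a1; rewrite aE gerDl ler10.
Qed.

Lemma E_BF_ones m : E_BF (nseq m (1 : R)) = m%:R.
Proof.
rewrite /E_BF (eq_bigr (fun=> m%:R)) => [|s _]; last first.
  by rewrite permute_ones BF_ones.
by rewrite sumr_const card_Sn -[_ *+ _`!]mulr_natr mulfK.
Qed.

End UnitItems.

(* Asymptotic random-order ratio of Best-Fit on items in (1/3,1] equals 1. *)
Theorem theorem1p3 (R : realType) :
  limn_esup (@sup_ratio_third R) = 1%E.
Proof.
rewrite /limn_esup /limf_esup; apply/eqP; rewrite eq_le; apply/andP; split.
  apply/lee_addgt0Pr => e e0.
  (* Half of [e] absorbs the relative error [53 / N]; the other half absorbs the additive constant
     [c] once [m] reaches [m0]. *)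
  pose N := (Num.truncn (106 / e)).+1.
  have Ne : 53 / N%:R <= e / 2.
    have : 106 / e < N%:R by exact: truncnS_gt.
    rewrite ltr_pdivrMr // => h.
    by rewrite ler_pdivrMr ?ltr0n //; lra.
  pose c : R := 1 + 2 * N%:R + 24 * N%:R ^+ 9.
  pose m0 := (Num.truncn (2 * c / e)).+1.
  pose V : set nat := [set m : nat | (m0 <= m)%N]%classic.
  apply: (@le_trans _ _ (ereal_sup (sup_ratio_third R @` V)%classic)).
    by apply: ereal_inf_lbound; exists V => //; exists m0.
  apply: ge_ereal_sup => _ [m /= mm0 <-]; apply: ge_ereal_sup.
  move=> _ [I [I13 [Im Imin]] <-].
  have m_gt0 : (0 < m)%N by apply: leq_trans mm0.
  (* An empty list packs into zero bins, which contradicts the minimality of a positive [m]. *)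
  have I0 : (0 < size I)%N.
    rewrite lt0n; apply/negP => /eqP s0; have : (m <= 0)%N; last by lia.
    apply: Imin; have f : 'I_(size I) -> 'I_0 by rewrite s0.
    by exists f; case.
  have I13' : all (fun x => 1/3 < x) I.
    by apply: sub_all I13 => x /andP[].
  have N0 : (0 < N)%N by [].
  rewrite -EFinD lee_fin ler_pdivrMr ?ltr0n //.
  apply: le_trans (E_BF_asymptotic N0 I0 I13' Im) _.
  have cm : c <= e / 2 * m%:R.
    have : 2 * c / e < m%:R.
      by apply: lt_le_trans (truncnS_gt _) _; rewrite ler_nat.
    by rewrite ltr_pdivrMr // => h; lra.
  have := ler_wpM2l (ler0n R m) Ne; move: cm; rewrite /c.
  lra.
apply: le_ereal_inf_tmp => _ [V [m0 _ Vm0] <-].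
(* Taking the maximum with 1 avoids [m = 0], where the ratio is 0 by the convention for division by
   zero. *)
apply: (@le_trans _ _ (sup_ratio_third R (maxn m0 1))); last first.
  apply: ereal_sup_ubound; exists (maxn m0 1) => //.
  by apply: Vm0; rewrite /= leq_maxl.
set m := maxn m0 1; have m_gt0 : (0 < m)%N by rewrite leq_maxr.
apply: (@le_trans _ _ (E_BF (nseq m (1 : R)) / m%:R)%:E); last first.
  apply: ereal_sup_ubound; exists (nseq m 1) => //.
  split; last exact: is_Opt_ones.
  by rewrite all_nseq /=; apply/orP; right; lra.
by rewrite E_BF_ones divff // pnatr_eq0 -lt0n.
Qed.
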